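(* For a non-autonomous discrete dynamical system $(X,f_{1,\infty})$ the following are equivalent: (i) The system $(X,f_{1,\infty})$ is strongly transitive. (ii) For every opene set $U\subset X$ and every point $x\in X$, there exists $n\in\mathbb{N}$ such that $x\in f_1^n(U)$. (iii) For every opene set $U\subset X$ and every point $x\in X$, the set $N(U,x)$ is nonempty. (iv) For every $x\in X$, the negative orbit $O^-(x,f_{1,\infty})$ is dense in $X$. (v) For every $x\in X$ and every $\epsilon>0$, there exists $N\in\mathbb{N}$ such that $O_N^-(x,f_{1,\infty})$ is $\epsilon$ dense in $X$.
   Context: $\mathbb{N}=\{1,2,3,\dots\}$. A non-autonomous discrete dynamical system (NDDS) is a pair $(X,f_{1,\infty})$ where $X$ is a compact metric space and $f_{1,\infty}=(f_n)_{n\in\mathbb{N}}$ is a sequence of continuous maps $f_n:X\to X$. For $n\in\mathbb{N}$, $f_1^n:=f_n\circ\cdots\circ f_1$, and $f_1^{-n}(x)=(f_1^n)^{-1}(\{x\})$ denotes the preimage. ''Opene'' means nonempty and open. $N(U,x)=\{n\in\mathbb{N}: f_1^n(U)\cap\{x\}\neq\emptyset\}$. The negative orbit of $x$ is $O^-(x,f_{1,\infty})=\bigcup_{n\in\mathbb{N}}f_1^{-n}(x)$ and, for $N\in\mathbb{N}$, $O_N^-(x,f_{1,\infty})=\bigcup_{1\le n\le N}f_1^{-n}(x)$. The system is strongly transitive if $\bigcup_{n=1}^\infty f_1^n(V)=X$ for every opene $V\subset X$. For $\epsilon>0$, a subset of $X$ is $\epsilon$ dense if it intersects every open ball of radius $\epsilon$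 in $X$. *)

(* Defs.v *)
From HB Require Import structures.
From mathcomp Require Import all_boot all_order all_algebra.
From mathcomp Require Import all_classical all_reals all_analysis.

Set Implicit Arguments.
Unset Strict Implicit.
Unset Printing Implicit Defensive.

Import Order.TTheory GRing.Theory Num.Theory.

Local Open Scope classical_set_scope.
Local Open Scope ring_scope.

(* A sequence f_1, f_2, ... of self-maps of X is given by f : nat -> X -> X.
   Times are the positive integers: the value f 0 is never used. *)

(* comp_to f n = f_n \o ... \o f_1, with the identity for n = 0. *)
Fixpoint comp_to (X : Type) (f : nat -> X -> X) (n : nat) : X -> X :=
  if n is m.+1 then f m.+1 \o comp_to f m else id.

Definition ndds (R : realType) (X : metricType R) (f : nat -> X -> X) : Prop :=
  compact [set: X] /\ (forall n, (1 <= n)%N -> continuous (f n)).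

Definition opene (X : topologicalType) (U : set X) : Prop :=
  U !=set0 /\ open U.

Definition strongly_transitive (X : topologicalType) (f : nat -> X -> X) :
    Prop :=
  forall V : set X, opene V -> \bigcup_(n >= 1) (comp_to f n @` V) = [set: X].

Definition hitting_times (X : Type) (f : nat -> X -> X) (U : set X) (x : X) :
    set nat :=
  [set n | (1 <= n)%N /\ (comp_to f n @` U) `&` [set x] !=set0].

Definition neg_orbit (X : Type) (f : nat -> X -> X) (x : X) : set X :=
  \bigcup_(n >= 1) (comp_to f n @^-1` [set x]).

Definition neg_orbit_upto (X : Type) (f : nat -> X -> X) (N : nat) (x : X) :
    set X :=
  \bigcup_(n in [set n | (1 <= n <= N)%N]) (comp_to f n @^-1` [set x]).

Definition eps_dense (R : realType) (X : metricType R) (e : R) (A : set X) :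
    Prop :=
  forall y : X, A `&` ball y e !=set0.

(* Main.v *)
Require Import Defs.
From HB Require Import structures.
From mathcomp Require Import all_boot all_order all_algebra.
From mathcomp Require Import all_classical all_reals all_analysis.

Import GRing.Theory Num.Theory.

Local Open Scope classical_set_scope.
Local Open Scope ring_scope.

(** A point [x] lies in the image of [U] under [comp_to f n] exactly when [U] meets the [n]-th
    preimage of [x]; so (i) to (iv) restate one another. Compactness turns density into the uniform
    bound of (v), and (v) gives back (i) at a radius whose ball fits inside the given open set. The
    implications are proved as a cycle. *)

Lemma neg_orbit_upto_eps_dense (R : realType) (X : metricType R)
    (f : nat -> X -> X) (x : X) (e : R) :
  compact [set: X] -> 0 < e -> dense (neg_orbit f x) ->
  exists N : nat, (1 <= N)%N /\ eps_dense e (neg_orbit_upto f N x).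
Proof.
move=> cX e0 xD.
have e20 : 0 < e / 2 by rewrite divr_gt0.
(* Being e-close to the truncated orbit is monotone in N and holds locally
   uniformly, so compactness makes it hold uniformly. *)
have [] := (compact_near_coveringP [set: X]).1 cX nat \oo
  (fun N y => neg_orbit_upto f N x `&` ball y e !=set0) _.
  move=> y _.
  have [||z [/interior_subset yz [n /= n1 nz]]] := xD (interior (ball y (e / 2))).
    by exists y; exact: nbhsx_ballx.
    exact: open_interior.
  (* The same [z] serves every centre within [e / 2] of [y] and every bound [m >= n]. *)
  exists (ball y (e / 2), [set m | (n <= m)%N]).
    by split; [exact: nbhsx_ballx | exists n].
  move=> [y' m] /= [yy' nm]; exists z; split.
    by exists n => //=; rewrite n1.
  by rewrite [e]splitr; apply: ball_triangle yz; exact: ball_sym.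
(* The threshold [N] may be 0; its successor is a positive time. *)
move=> N _ HN; exists N.+1; split => // y.
by apply: (HN N.+1) => //=.
Qed.

Theorem theorem3p3 (R : realType) (X : metricType R) (f : nat -> X -> X)
    (hf : ndds f) :
  [<->
    (* i *)   strongly_transitive f;
    (* ii *)  forall (U : set X) (x : X), opene U ->
                exists n : nat, (1 <= n)%N /\ (comp_to f n @` U) x;
    (* iii *) forall (U : set X) (x : X), opene U ->
                hitting_times f U x !=set0;
    (* iv *)  forall x : X, dense (neg_orbit f x);
    (* v *)   forall (x : X) (e : R), 0 < e ->
                exists N : nat, (1 <= N)%N /\ eps_dense e (neg_orbit_upto f N x)].
Proof.
tfae.
- move=> st U x /st Ux; have : [set: X] x by [].
  by rewrite -Ux => -[n n1 nx]; exists n.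
- move=> h U x /(h _ x) [n [n1 nx]].
  by exists n; split => //; exists x.
- move=> h x U U0 oU.
  have [n [n1 [_ [[y Uy <-] yx]]]] := h U x (conj U0 oU).
  by exists y; split => //; exists n.
- by move=> h x e e0; apply: neg_orbit_upto_eps_dense => //; exact: hf.1.
- move=> h V [[v Vv] oV]; rewrite -subTset => x _.
  (* A preimage of [x] in a ball around [v] inside [V] is the point of [V] sent to [x]. *)
  have /nbhs_ballP[e /= e0 eV] := open_nbhs_nbhs (conj oV Vv).
  have [N [_ /(_ v)[z [[n /= /andP[n1 _] nz] /eV Vz]]]] := h x e e0.
  by exists n => //; exists z.
Qed.
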